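(* Let $0<\alpha<1$, $\nu>0$, $T>1$, let $G\subset\mathbb{R}^n$ be a bounded domain with smooth boundary $\partial G$, and put $\Omega=G\times(1,T]$. Let $F:\overline\Omega\times\mathbb{R}\to\mathbb{R}$, $\varphi:\bar G\to\mathbb{R}$ and $\psi:\partial G\times[1,T]\to\mathbb{R}$ be continuous. If $F(x,t,u)$ is nonincreasing with respect to $u$, then the nonlinear fractional diffusion problem $$D_{*,t}^{\alpha}u(x,t)=\nu\Delta_x u(x,t)+F(x,t,u(x,t)),\quad (x,t)\in\Omega,$$ $$u(x,1)=\varphi(x),\ x\in\bar G,\qquad u(x,t)=\psi(x,t),\ x\in\partial G,\ 1\le t\le T,$$ admits at most one solution $u\in C^2(\bar G)\cap H^1((1,T])$ (that is, $C^2(\bar G)$ in the variable $x$ and $H^1((1,T])$ in the variable $t$).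
   Context: $\Delta_x u=\sum_{j=1}^n\partial^2u/\partial x_j^2$, $\overline\Omega=\bar G\times[1,T]$, $H^1=W^1_2$ is the Sobolev space, and $D_{*,t}^{\alpha}$ is the Hadamard-type fractional derivative in $t$ with base point $1$: $$D_{*,t}^{\alpha}u(x,t)=\frac{1}{\Gamma(1-\alpha)}\int_1^t\left(\log\frac{t}{s}\right)^{-\alpha}\frac{\partial u}{\partial s}(x,s)\,ds .$$ Solutions are classical: $u\in C(\overline\Omega)$ is real-valued, the integral defining $D_{*,t}^{\alpha}u(x,t)$ converges absolutely at every $(x,t)\in\Omega$, and the equation holds at every point of $\Omega$. *)

(* Defs.v *)
From HB Require Import structures.
From mathcomp Require Import all_boot all_order all_algebra.
From mathcomp Require Import all_classical all_reals all_analysis.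

Set Implicit Arguments.
Unset Strict Implicit.
Unset Printing Implicit Defensive.

Import Order.TTheory GRing.Theory Num.Theory.
Import numFieldNormedType.Exports.

Local Open Scope classical_set_scope.
Local Open Scope ring_scope.

Section SpaceRegularity.
Context {R : realType}.

(* partial [:: i1; ...; ik] f = d/dx_i1 (d/dx_i2 (... (d/dx_ik f))) *)
Definition partial (n : nat) (s : seq 'I_n) (f : 'rV[R]_n -> R) :
    'rV[R]_n -> R :=
  foldr (fun i g => 'D_(delta_mx 0 i) g) f s.

Definition Ck_open (n k : nat) (G : set 'rV[R]_n) (f : 'rV[R]_n -> R) : Prop :=
  forall s : seq 'I_n, (size s <= k)%N ->
    (forall x, G x -> {for x, continuous (partial s f)}) /\
    ((size s < k)%N ->
      forall (i : 'I_n) x, G x -> derivable (partial s f) x (delta_mx 0 i)).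

(* C^k of the closure of the open set G: all partial derivatives of order <= k
   computed in G extend continuously to the closure; the values of f outside
   the closure of G are irrelevant. *)
Definition Ck_closure (n k : nat) (G : set 'rV[R]_n) (f : 'rV[R]_n -> R) :
    Prop :=
  [/\ {within closure G, continuous f},
      Ck_open k G f &
      forall s : seq 'I_n, (size s <= k)%N ->
        exists2 g : 'rV[R]_n -> R, {within closure G, continuous g} &
          forall x, G x -> g x = partial s f x].

Definition Cinfty (n : nat) (f : 'rV[R]_n -> R) : Prop :=
  forall k, Ck_open k setT f.

Definition laplacian (n : nat) (f : 'rV[R]_n -> R) (x : 'rV[R]_n) : R :=
  \sum_(i < n) partial [:: i; i] f x.

Definition boundary (n : nat) (G : set 'rV[R]_n) : set 'rV[R]_n :=
  closure G `\` interior G.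

Definition domain (n : nat) (G : set 'rV[R]_n) : Prop :=
  [/\ open G, connected G & G !=set0].

(* Near each boundary point, after choosing a coordinate x_i and an orientation
   of its axis (the sign given by b), G is the strict epigraph of a C^infty
   function of the n - 1 remaining coordinates col' i x. *)
Definition smooth_boundary (n : nat) (G : set 'rV[R]_n) : Prop :=
  forall p, boundary G p ->
    exists (i : 'I_n) (b : bool) (gamma : 'rV[R]_n.-1 -> R),
      Cinfty gamma /\
      \forall x \near p, G x <-> gamma (col' i x) < (-1) ^+ b * x 0 i.

End SpaceRegularity.

Section TimeRegularity.
Context {R : realType}.
Local Notation mu := (@lebesgue_measure R).

Definition L2_itv (a b : R) (f : R -> R) : Prop :=
  measurable_fun `]a, b[%classic f /\
  mu.-integrable `]a, b[%classic (fun s => ((f s) ^+ 2)%:E).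

(* C^infty functions on R with compact support in ]a, b[ *)
Definition test_function (a b : R) (phi : R -> R) : Prop :=
  (forall (k : nat) (s : R), derivable (derive1n k phi) s 1) /\
  exists c d : R, [/\ a < c, d < b & forall s, s \notin `[c, d] -> phi s = 0].

Definition is_weak_derivative (a b : R) (f g : R -> R) : Prop :=
  forall phi, test_function a b phi ->
    Rintegral mu `]a, b[%classic (fun s => f s * derive1 phi s) =
    - Rintegral mu `]a, b[%classic (fun s => g s * phi s).

Definition H1_itv (a b : R) (f : R -> R) : Prop :=
  L2_itv a b f /\ exists2 g, L2_itv a b g & is_weak_derivative a b f g.

(* A chosen representative of the weak derivative in L^2(a, b), which is unique
   up to a null set; the zero function if f has no such derivative. *)
Definition weak_derivative (a b : R) (f : R -> R) : R -> R :=
  xget (fun=> 0) [set g | L2_itv a b g /\ is_weak_derivative a b f g].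

Definition Gamma (z : R) : R :=
  Rintegral mu `]0, +oo[%classic (fun s => s `^ (z - 1) * expR (- s)).

(* Integrand of the Hadamard-type derivative at time t of f : ]1, T] -> R *)
Definition hadamard_integrand (alpha T : R) (f : R -> R) (t s : R) : R :=
  ln (t / s) `^ (- alpha) * weak_derivative 1 T f s.

Definition hadamard_defined (alpha T : R) (f : R -> R) (t : R) : Prop :=
  mu.-integrable `]1, t[%classic
    (fun s => (hadamard_integrand alpha T f t s)%:E).

Definition hadamard (alpha T : R) (f : R -> R) (t : R) : R :=
  (Gamma (1 - alpha))^-1 *
  Rintegral mu `]1, t[%classic (hadamard_integrand alpha T f t).

End TimeRegularity.

Record solution {R : realType} (n : nat) (alpha nu T : R) (G : set 'rV[R]_n)
    (F : 'rV[R]_n -> R -> R -> R) (phi : 'rV[R]_n -> R)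
    (psi : 'rV[R]_n -> R -> R) (u : 'rV[R]_n -> R -> R) : Prop := Solution {
  sol_continuous :
    {within closure G `*` `[1, T]%classic, continuous (fun z => u z.1 z.2)};
  sol_C2 : forall t, 1 < t <= T -> Ck_closure 2 G (fun x => u x t);
  sol_H1 : forall x, closure G x -> H1_itv 1 T (u x);
  sol_defined : forall x t, G x -> 1 < t <= T ->
    hadamard_defined alpha T (u x) t;
  sol_equation : forall x t, G x -> 1 < t <= T ->
    hadamard alpha T (u x) t =
    nu * laplacian (fun y => u y t) x + F x t (u x t);
  sol_initial : forall x, closure G x -> u x 1 = phi x;
  sol_boundary : forall x t, boundary G x -> 1 <= t <= T -> u x t = psi x t
}.

(* Main.v *)
Require Import Defs.
From HB Require Import structures.
From mathcomp Require Import all_boot all_order all_algebra.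
From mathcomp Require Import all_classical all_reals all_analysis.
From mathcomp Require Import measurable_realfun ring lra.

Set Implicit Arguments.
Unset Strict Implicit.
Unset Printing Implicit Defensive.

Import Order.TTheory GRing.Theory Num.Theory.
Import numFieldNormedType.Exports.

Local Open Scope classical_set_scope.
Local Open Scope ring_scope.

(** The proof is by the maximum principle: of two solutions $u$ and $v$, the
    difference $w = u - v$ cannot have a positive maximum over the compact
    cylinder $\bar G \times [1, T]$, and exchanging $u$ and $v$ gives equality.

    A positive maximum would be attained at a point $(x_0, t_0)$ with
    $x_0 \in G$ and $t_0 > 1$, since $w$ vanishes on the boundary and at time
    $1$. The Laplacian of $w$ is nonpositive there
    ([laplacian_sub_at_max]) and $F(\cdot, u) \le F(\cdot, v)$ because
    $u > v$, so the equation makes the fractional derivative of $u$ at most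
    that of $v$. On the other hand the increment of $w(x_0, \cdot)$ over
    $[s, t_0]$ is nonnegative for every $s$ and positive for $s = 1$, and the
    kernel $\log(t_0/s)^{-\alpha}$ is positive and increasing in $s$; this
    forces $D^\alpha u > D^\alpha v$ at $(x_0, t_0)$ ([hadamard_lt_at_max]), a
    contradiction.

    The last step is the substantial one, because the derivative in time is
    only weak. Three facts carry it.
    - A continuous function with an integrable weak derivative $g$ satisfies
      $f(t) - f(s) = \int_s^t g$, up to the ends of the interval
      ([weak_derivative_primitive]). The weak derivative is tested against
      smooth hats built from $e^{-1/x}$ that converge to the indicator of
      $]s, t[$ and whose derivatives converge to $\delta_s - \delta_t$.
    - If $k$ is nondecreasing, $k \ge c$, and all the integrals
      $\int_s^b g$ are nonnegative, then $\int_a^b k g \ge c \int_a^b g$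
      ([Rintegral_nondecreasing_ge]). This replaces the integration by parts
      of the usual proof; the singularity of the kernel at $t_0$ enters only
      through the integrability of $k g$.
    - $\Gamma(1 - \alpha) > 0$ ([Gamma_gt0]), so that the normalising factor of
      the derivative preserves the sign. *)

(** * Derivatives, primitives and powers *)

Section CalculusComplements.
Context {R : realType}.
Local Notation mu := (@lebesgue_measure R).

Lemma is_derive1_continuous (F : R -> R) (x l : R) :
  is_derive x 1 F l -> {for x, continuous F}.
Proof.
by move=> [dF _]; apply/differentiable_continuous/derivable1_diffP.
Qed.

Lemma integral_is_derive (f F : R -> R) (a b : R) : a < b ->
  (forall x, a <= x <= b -> is_derive x 1 F (f x)) ->
  {within `[a, b], continuous f} ->
  (\int[mu]_(x in `[a, b]) (f x)%:E = (F b - F a)%:E)%E.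
Proof.
move=> ab dF cf.
have cF x : a <= x <= b -> {for x, continuous F}.
  by move=> /dF; exact: is_derive1_continuous.
rewrite EFinB; apply: continuous_FTC2 => //.
- split.
  + by move=> x /[!in_itv]/= /andP[ax xb]; case: (dF x); rewrite ?ltW.
  + by apply: cvg_at_right_filter; apply: cF; rewrite lexx ltW.
  + by apply: cvg_at_left_filter; apply: cF; rewrite lexx ltW.
- move=> x /[!in_itv]/= /andP[ax xb]; rewrite derive1E.
  by case: (dF x); rewrite ?ltW.
Qed.

Lemma Rintegral_is_derive (f F : R -> R) (a b : R) : a <= b ->
  (forall x, a <= x <= b -> is_derive x 1 F (f x)) ->
  {within `[a, b], continuous f} ->
  Rintegral mu `[a, b]%classic f = F b - F a.
Proof.
rewrite le_eqVlt => /predU1P[<- _ _|ab dF cf].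
  by rewrite set_itv1 Rintegral_set1 subrr.
by rewrite /Rintegral (integral_is_derive ab dF cf).
Qed.

Lemma powR_le_nonpos (x y p : R) : 0 < x -> x <= y -> p <= 0 ->
  y `^ p <= x `^ p.
Proof.
move=> x0 xy p0; have y0 := lt_le_trans x0 xy.
rewrite -(opprK p) !(powRN _ (- p)) lef_pV2 ?posrE ?powR_gt0//.
by apply: ge0_ler_powR; rewrite ?nnegrE ?oppr_ge0// ltW.
Qed.

End CalculusComplements.

(** * Positivity of the Gamma function on the unit interval *)

Section GammaPositive.
Context {R : realType}.
Local Notation mu := (@lebesgue_measure R).

Let h (b s : R) : R := s `^ (b - 1) * expR (- s).

Lemma measurable_gamma_integrand (b : R) (D : set R) :
  measurable_fun D (h b).
Proof.
apply: measurable_funTS; apply: measurable_funM.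
  exact: measurable_powR.
apply: measurableT_comp => //; exact: measurable_expR.
Qed.

(** The primitive $(1 - e^{-s})^b / b$ is bounded on the half-line, and since
    $1 - e^{-s} \le s$ and $b < 1$ its derivative dominates the integrand of the Gamma
    function: this settles integrability at $0$ and at infinity at once. *)
Lemma gamma_integrand_itv_le (b c d : R) : 0 < b < 1 -> 0 < c -> c < d ->
  (\int[mu]_(s in `[c, d]) (h b s)%:E <= (b^-1)%:E)%E.
Proof.
move=> /andP[b0 b1] c0 cd.
pose G (s : R) := (1 - expR (- s)) `^ b / b.
pose g (s : R) := (1 - expR (- s)) `^ (b - 1) * expR (- s).
have pos (s : R) : 0 < s -> 0 < 1 - expR (- s).
  by move=> s0; rewrite subr_gt0 expR_lt1 oppr_lt0.
have dE (s : R) : is_derive s 1 (fun s => 1 - expR (- s)) (expR (- s)).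
  apply: is_derive_eq.
  by rewrite add0r mul1r mulrN1 opprK.
have dG s : c <= s <= d -> is_derive s 1 G (g s).
  move=> /andP[cs sd]; have s0 := lt_le_trans c0 cs.
  pose P := fun y : R => y `^ b.
  have dP : is_derive (1 - expR (- s)) 1 P (b * (1 - expR (- s)) `^ (b - 1)).
    by apply: is_derive1_powR; exact: pos.
  have -> : G = (P \o (fun s => 1 - expR (- s))) * cst (b^-1).
    by apply/funext => x.
  have dPo := @is_derive1_comp _ P (fun s => 1 - expR (- s)) s _ _ dP (dE s).
  have := is_deriveM dPo (is_derive_cst b^-1 s 1).
  move=> dGs; apply: (is_derive_eq dGs).
  rewrite /g /GRing.scale/= mulr0 add0r.
  by rewrite -mulrA mulKf ?gt_eqF.
have cg : {within `[c, d], continuous g}.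
  apply: continuous_in_subspaceT => s; rewrite inE/= in_itv/= => /andP[cs sd].
  have s0 := lt_le_trans c0 cs.
  have dP := is_derive1_powR (b - 1) (pos _ s0).
  have c1 := continuous_comp (is_derive1_continuous (dE s))
    (is_derive1_continuous dP).
  have c2 : {for s, continuous (fun s : R => expR (- s))}.
    by apply: continuous_comp; [exact: opp_continuous|exact: continuous_expR].
  exact: (continuousM c1 c2).
apply: (@le_trans _ _ (\int[mu]_(s in `[c, d]) (g s)%:E)%E).
  apply: ge0_le_integral => //.
  - by move=> s _; rewrite lee_fin mulr_ge0// ?powR_ge0 ?expR_ge0.
  - by apply/measurable_EFinP; exact: measurable_gamma_integrand.
  - by apply/measurable_EFinP; exact: subspace_continuous_measurable_fun.
  - move=> s; rewrite /= in_itv/= => /andP[cs sd].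
    have s0 := lt_le_trans c0 cs.
    rewrite lee_fin ler_wpM2r ?expR_ge0//.
    apply: powR_le_nonpos; [exact: pos| |by rewrite subr_le0 ltW].
    have := expR_ge1Dx (- s); lra.
rewrite (integral_is_derive cd dG cg) lee_fin.
rewrite -mulrBl ler_piMl ?invr_ge0 ?(ltW b0)//.
have Gle1 : (1 - expR (- d)) `^ b <= 1.
  have P1 : 1 `^ b = 1 :> R by rewrite powR1.
  rewrite -[leRHS]P1.
  have d0 := pos d (lt_trans c0 cd).
  have d1 : 1 - expR (- d) <= 1 by rewrite gerBl expR_ge0.
  by apply: ge0_ler_powR; rewrite // ?nnegrE// ltW.
by rewrite (le_trans _ Gle1)// gerBl powR_ge0.
Qed.

Lemma gamma_integrable (b : R) : 0 < b < 1 ->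
  mu.-integrable `]0, +oo[%classic (EFin \o h b).
Proof.
move=> b01; apply/integrableP; split.
  by apply/measurable_EFinP; exact: measurable_gamma_integrand.
under eq_integral do rewrite /= ger0_norm ?mulr_ge0 ?powR_ge0 ?expR_ge0//.
pose S (k : nat) := `[k.+1%:R^-1, k.+2%:R : R]%classic.
have itvE : `]0, +oo[%classic = \bigcup_k S k.
  apply/seteqP; split => [s|s [k _]]; rewrite /S/= !in_itv/= ?andbT.
    move=> s0.
    have [k ks] : exists k : nat, s + s^-1 < k%:R.
      by exists (Num.truncn (s + s^-1)).+1; exact: truncnS_gt.
    have si0 : 0 < s^-1 by rewrite invr_gt0.
    exists k => //; rewrite /= in_itv/=; apply/andP; split.
      rewrite -[leRHS]invrK lef_pV2 ?posrE// -addn1 natrD; lra.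
    by rewrite -addn2 natrD; lra.
  by move=> /andP[+ _]; apply: lt_le_trans; rewrite invr_gt0.
rewrite itvE.
have := @ge0_nondecreasing_set_cvg_integral _ (measurableTypeR R) _ S
  (EFin \o h b) mu.
have hS : nondecreasing_seq S.
  move=> i j ij; apply/subsetPset; rewrite /S; apply: subset_itv; rewrite bnd_simp.
    by rewrite lef_pV2 ?posrE// ler_nat ltnS.
  by rewrite ler_nat !ltnS.
move=> /(_ hS) cvgS.
have {}cvgS : (\int[mu]_(x in S i) (h b x)%:E @[i --> \oo] -->
    \int[mu]_(x in \bigcup_i S i) (h b x)%:E)%E.
  apply: cvgS.
  - by move=> i; exact: measurable_itv.
  - by move=> i; apply/measurable_EFinP; exact: measurable_gamma_integrand.
  - by move=> i x _; rewrite lee_fin mulr_ge0// ?powR_ge0 ?expR_ge0.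
apply: le_lt_trans (ltry b^-1); rewrite -(cvg_lim _ cvgS)//.
apply: lime_le; first exact: cvgP cvgS.
apply: nearW => k; apply: gamma_integrand_itv_le => //.
rewrite (@le_lt_trans _ _ 1)// ?invf_le1 ?ltr1n// ler1n//.
Qed.

Lemma Gamma_gt0 (b : R) : 0 < b < 1 -> 0 < Gamma b.
Proof.
move=> b01; have ih := gamma_integrable b01.
pose m := 2 `^ (b - 1) * expR (- 2) : R.
have m0 : 0 < m by rewrite mulr_gt0 ?powR_gt0 ?expR_gt0.
apply: (lt_le_trans m0); rewrite -lee_fin fineK; last first.
  exact: integrable_fin_num.
have s12 : (`[1, 2]%classic : set R) `<=` `]0, +oo[%classic.
  by move=> s; rewrite /= !in_itv/= andbT => /andP[+ _]; exact: lt_le_trans.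
apply: (@le_trans _ _ (\int[mu]_(s in `[1%R, 2%R]) (h b s)%:E)%E); last first.
  apply: ge0_subset_integral => //.
    by apply/measurable_EFinP; exact: measurable_gamma_integrand.
  by move=> x _; rewrite lee_fin mulr_ge0// ?powR_ge0 ?expR_ge0.
have <- : (\int[mu]_(s in `[1%R, 2%R]) m%:E = m%:E)%E.
  rewrite integral_cst//= lebesgue_measure_itv/= lte_fin ltr1n -EFinB.
  by rewrite (_ : 2 - 1 = 1 :> R) ?mule1//; lra.
apply: ge0_le_integral => //.
- by move=> s _; rewrite lee_fin ltW.
- by apply/measurable_EFinP; exact: measurable_gamma_integrand.
- move=> s; rewrite /= in_itv/= => /andP[s1 s2]; rewrite lee_fin.
  apply: ler_pM; rewrite ?powR_ge0 ?expR_ge0 ?ler_expR ?lerN2//.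
  apply: powR_le_nonpos; rewrite ?(lt_le_trans _ s1)// subr_le0.
  by case/andP: b01 => _ /ltW.
Qed.

End GammaPositive.

(** * Smooth functions of one variable *)

Section SmoothFunctions.
Context {R : realType}.
Implicit Types (f g : R -> R).

(** Being $k$ times differentiable, by recursion from the inside: unlike
    the iterated derivative, this form is stable under products by a plain
    induction on $k$. *)
Fixpoint differentiable_times (k : nat) f : Prop :=
  if k is k'.+1 then
    (forall s, derivable f s 1) /\ differentiable_times k' (derive1 f)
  else True.

Definition smooth f := forall k, differentiable_times k f.

Lemma smooth_derivable_derive1n f k s :
  smooth f -> derivable (derive1n k f) s 1.
Proof.
move=> sf; have := sf k.+1.
elim: k f {sf} => [|k IHk] f; first by case.
by rewrite derive1Sn => -[_]; exact: IHk.
Qed.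

Lemma differentiable_timesW k f :
  differentiable_times k.+1 f -> differentiable_times k f.
Proof. by elim: k f => [//|k IHk] f [df /IHk]. Qed.

Lemma differentiable_timesD k f g :
  differentiable_times k f -> differentiable_times k g ->
  differentiable_times k (f + g).
Proof.
elim: k f g => [//|k IHk] f g [df kf] [dg kg]; split.
  by move=> s; exact: derivableD.
rewrite (_ : derive1 (f + g) = derive1 f + derive1 g); first exact: IHk.
by apply/funext => s; rewrite derive1E (deriveD (df s) (dg s)) -!derive1E.
Qed.

Lemma differentiable_timesM k f g :
  differentiable_times k f -> differentiable_times k g ->
  differentiable_times k (f * g).
Proof.
elim: k f g => [//|k IHk] f g fk gk.
have [df kf] := fk; have [dg kg] := gk; split.
  by move=> s; exact: derivableM.
rewrite (_ : derive1 (f * g) = f * derive1 g + g * derive1 f).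
  by apply: differentiable_timesD; apply: IHk => //; exact: differentiable_timesW.
by apply/funext => s; rewrite derive1E (deriveM (df s) (dg s)) -!derive1E.
Qed.

Lemma differentiable_times_cst k (c : R) : differentiable_times k (cst c).
Proof.
elim: k c => [//|k IHk] c; split; first by move=> s; exact: derivable_cst.
rewrite (_ : derive1 (cst c) = cst 0); first exact: IHk.
by apply/funext => s; rewrite derive1_cst.
Qed.

Lemma is_derive_comp_affine f (m d x l : R) : is_derive (m * x + d) 1 f l ->
  is_derive x 1 (fun y => f (m * y + d)) (m * l).
Proof.
move=> df.
have dA : is_derive x 1 (fun y : R => m * y + d) m.
  by apply: is_derive_eq; rewrite addr0 /GRing.scale/= mulr1.
by rewrite mulrC; exact: (@is_derive1_comp _ f (fun y => m * y + d) x _ _ df dA).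
Qed.

Lemma differentiable_times_comp_affine k f (m d : R) :
  differentiable_times k f ->
  differentiable_times k (fun x => f (m * x + d)).
Proof.
elim: k f => [//|k IHk] f [df kf].
have dE (x : R) :
    is_derive x 1 (fun y : R => f (m * y + d)) (m * derive1 f (m * x + d)).
  by apply: is_derive_comp_affine; rewrite derive1E; exact/derivableP.
split; first by move=> s; case: (dE s).
rewrite (_ : derive1 _ = cst m * (fun x => derive1 f (m * x + d))).
  by apply: differentiable_timesM; [exact: differentiable_times_cst|exact: IHk].
by apply/funext => x; rewrite derive1E; case: (dE x).
Qed.

End SmoothFunctions.

(** * Functions flat at the origin *)

Section FlatFunctions.
Context {R : realType}.
Implicit Types (P Q : {poly R}).

(** The polynomial factor makes the family stable under differentiation, so
    that smoothness of $e^{-1/x}$ follows by induction from differentiability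
    of every member. *)
Definition flat P (x : R) : R :=
  if 0 < x then P.[x^-1] * expR (- x^-1) else 0.

Lemma flat_le0 P x : x <= 0 -> flat P x = 0.
Proof. by rewrite /flat => x0; rewrite ltNge x0. Qed.

Lemma flat_gt0 P x : 0 < x -> flat P x = P.[x^-1] * expR (- x^-1).
Proof. by rewrite /flat => ->. Qed.

Lemma exprn_expRN_le (n : nat) (y : R) : 0 <= y ->
  y ^+ n * expR (- y) <= n`!%:R.
Proof.
move=> y0; rewrite expRN ler_pdivrMr ?expR_gt0//.
have n0 : (0 : R) < n`!%:R by rewrite ltr0n fact_gt0.
case: n n0 => [|n] n0.
  by rewrite expr0 fact0 mul1r; have := expR_ge1Dx y; lra.
rewrite -ler_pdivrMl// mulrC; have := expR_ge1Dxn n y0; lra.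
Qed.

(** Each monomial of $P(1/x)$ is absorbed by $e^{-1/x}$ with one power of $x$
    to spare. *)
Lemma flat_le P : exists C : R, forall x, `|flat P x| <= C * `|x|.
Proof.
exists (\sum_(i < size P) `|P`_i| * i.+1`!%:R) => x.
have C0 : 0 <= \sum_(i < size P) `|P`_i| * i.+1`!%:R.
  by apply: sumr_ge0 => i _; rewrite mulr_ge0.
have [x0|x0] := leP x 0.
  by rewrite flat_le0// normr0 mulr_ge0.
rewrite flat_gt0// horner_coef normrM (gtr0_norm (expR_gt0 _)) (gtr0_norm x0).
rewrite -ler_pdivrMr//.
apply: (@le_trans _ _
    ((\sum_(i < size P) `|P`_i| * x^-1 ^+ i) * expR (- x^-1) / x)).
  rewrite ler_wpM2r ?invr_ge0 ?(ltW x0)// ler_wpM2r ?expR_ge0//.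
  apply: (le_trans (ler_norm_sum _ _ _)); apply: ler_sum => i _.
  by rewrite normrM normrX (@ger0_norm _ x^-1)// invr_ge0 ltW.
rewrite -mulrA mulr_suml; apply: ler_sum => i _.
rewrite -mulrA ler_wpM2l//.
rewrite mulrCA -exprSr mulrC exprn_expRN_le// invr_ge0 ltW//.
Qed.

Lemma continuous_flat0 P : {for 0, continuous (flat P)}.
Proof.
have [C hC] := flat_le P.
apply/cvgrPdist_le => /= e e0; rewrite flat_le0//.
near=> x; rewrite sub0r normrN (le_trans (hC x))//.
have : `|x| <= e / (`|C| + 1).
  near: x; apply: (@nbhs0_le _ R^o); rewrite divr_gt0// ltr_wpDl.
rewrite ler_pdivlMr ?ltr_wpDl// => xe; apply: le_trans xe.
rewrite mulrC ler_wpM2l// (le_trans (ler_norm _))// lerDl.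
Unshelve. all: by end_near. Qed.

Lemma is_derive_flat P (x : R) :
  is_derive x 1 (flat P) (flat ('X^2 * (P - P^`())) x).
Proof.
have [x0|x0|->] := ltgtP x 0.
- rewrite flat_le0 ?ltW//.
  apply: (@near_eq_is_derive _ _ _ (cst 0 : R -> R)).
  by near=> y; rewrite flat_le0//; near: y; exact: lt_le_nbhsl.
- rewrite flat_gt0//.
  pose F (y : R) := P.[y] * expR (- y).
  have dF (y : R) : is_derive y 1 F ((P^`().[y] - P.[y]) * expR (- y)).
    have dE : is_derive y 1 (fun y : R => expR (- y)) (- expR (- y)).
      by apply: is_derive_eq; rewrite mulrN1.
    have dPE := is_deriveM (is_derive_poly P y) dE.
    apply: (is_derive_eq dPE).
    by rewrite /GRing.scale/= mulrN mulrBl addrC (mulrC (expR _)).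
  have dV : is_derive x 1 (fun y : R => y^-1) (- x ^- 2).
    apply: is_derive_eq; first by apply: is_deriveV; rewrite gt_eqF.
    by rewrite /GRing.scale/= mulr1.
  apply: (@near_eq_is_derive _ _ _ (F \o (fun y => y^-1))).
    by near=> y; rewrite /= flat_gt0//; near: y; exact: lt_nbhsr.
  have dC := @is_derive1_comp _ F (fun y => y^-1) x _ _ (dF _) dV.
  apply: (is_derive_eq dC).
  rewrite hornerM hornerXn hornerD hornerN exprVn.
  ring.
- (* The difference quotient of [flat P] at 0 is [flat ('X * P)]. *)
  rewrite flat_le0//; apply/is_derive1_caratheodory.
  exists (flat ('X * P)); split.
  + move=> z; rewrite subr0 (flat_le0 P (lexx 0)) subr0.
    have [z0|z0] := leP z 0; first by rewrite !flat_le0// mul0r.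
    rewrite !flat_gt0// hornerM hornerX.
    by rewrite [RHS]mulrC !mulrA divff ?gt_eqF// mul1r.
  + exact: continuous_flat0.
  + by rewrite flat_le0.
Unshelve. all: by end_near. Qed.

Lemma smooth_flat P : smooth (flat P).
Proof.
move=> k; elim: k P => [//|k IHk] P; split.
  by move=> s; case: (is_derive_flat P s).
rewrite (_ : derive1 _ = flat ('X^2 * (P - P^`()))); first exact: IHk.
by apply/funext => x; rewrite derive1E; case: (is_derive_flat P x).
Qed.

End FlatFunctions.

(** * Smooth approximations of the indicator of an interval *)

Section Hat.
Context {R : realType}.
Local Notation mu := (@lebesgue_measure R).
Implicit Types (f phi dphi psi dpsi : R -> R).

Lemma within_itv_dist f (s t x e : R) : {within `[s, t], continuous f} ->
  s <= x <= t -> 0 < e -> exists2 d, 0 < d &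
  forall y, s <= y <= t -> `|y - x| < d -> `|f y - f x| <= e.
Proof.
move=> /subspace_continuousP cf xst e0.
have /cf/cvgrPdist_le/(_ e e0) : `[s, t]%classic x by rewrite /= in_itv.
rewrite near_withinE => /nbhs_ballP[d d0 hd]; exists d => // y yst yx.
rewrite distrC; apply: hd; last by rewrite /= in_itv.
by rewrite /ball/= distrC.
Qed.

Lemma Rintegral_itv_cat f (a b x : R) : a <= x -> x <= b ->
  mu.-integrable `[a, b]%classic (EFin \o f) ->
  Rintegral mu `[a, b]%classic f =
  Rintegral mu `[a, x]%classic f + Rintegral mu `[x, b]%classic f.
Proof.
move=> ax xb intf.
have -> : Rintegral mu `[x, b]%classic f = Rintegral mu `]x, b]%classic f.
  rewrite Rintegral_itv_obnd_cbnd//; apply: integrableS intf => //.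
  by apply: subset_itv; rewrite bnd_simp.
by rewrite -(Rintegral_itvB intf) ?bnd_simp// subrKC.
Qed.

(** The bookkeeping of [cvg_Rintegral_dhat]: $r_i$ and $f_i$ are the values of
    the rising and falling steps at $s$, $s + d$, $t - d$, $t$; the integrals
    $I_i$ over the three intervals are known up to oscillation times variation;
    at the two inner points the steps are within $h$ of $1$. *)
Let concentration_le (e M h F G I1 I2 I3 r0 f0 r1 f1 r2 f2 r3 f3 : R) :
  0 <= e -> 0 <= M -> 0 <= h -> M * h = e -> `|F| <= M -> `|G| <= M ->
  `|I1 - F * (r1 * f1 - r0 * f0)| <= e * ((r1 - f1) - (r0 - f0)) ->
  `|I2 - 0 * (r2 * f2 - r1 * f1)| <= M * ((r2 - f2) - (r1 - f1)) ->
  `|I3 - G * (r3 * f3 - r2 * f2)| <= e * ((r3 - f3) - (r2 - f2)) ->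
  0 <= r0 <= 1 -> 0 <= f0 <= 1 -> 0 <= r1 <= 1 -> 0 <= f1 <= 1 ->
  0 <= r2 <= 1 -> 0 <= f2 <= 1 -> 0 <= r3 <= 1 -> 0 <= f3 <= 1 ->
  r0 * f0 = 0 -> r3 * f3 = 0 ->
  1 - h <= r1 -> 1 - h <= r2 -> 1 - h <= f1 -> 1 - h <= f2 ->
  `|F - G - (I1 + (I2 + I3))| <= 10 * e.
Proof.
move=> e0 M0 h0 Mh FM GM I1e I2e I3e r0_01 f0_01 r1_01 f1_01 r2_01 f2_01 r3_01
  f3_01 b0 b3 r1h r2h f1h f2h.
have b1 : 0 <= 1 - r1 * f1 <= 2 * h.
  have : 0 <= (1 - r1) * (1 - f1) by apply: mulr_ge0; lra.
  have : r1 * f1 <= 1 by apply: mulr_ile1; lra.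
  lra.
have b2 : 0 <= 1 - r2 * f2 <= 2 * h.
  have : 0 <= (1 - r2) * (1 - f2) by apply: mulr_ge0; lra.
  have : r2 * f2 <= 1 by apply: mulr_ile1; lra.
  lra.
have J1 : e * ((r1 - f1) - (r0 - f0)) <= e * 2 by apply: ler_wpM2l => //; lra.
have J3 : e * ((r3 - f3) - (r2 - f2)) <= e * 2 by apply: ler_wpM2l => //; lra.
have J2 : M * ((r2 - f2) - (r1 - f1)) <= M * (2 * h).
  by apply: ler_wpM2l => //; lra.
have K b H : `|H| <= M -> 0 <= b <= 2 * h -> `|H * b| <= M * (2 * h).
  by move=> HM /andP[bge0 bh]; rewrite normrM (ger0_norm bge0) ler_pM.
have := K _ _ FM b1; have := K _ _ GM b2.
rewrite mulrCA Mh in J2 *.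
rewrite b0 b3 mul0r !subr0 sub0r in I1e I2e I3e.
move: J1 J2 J3 I1e I2e I3e; rewrite !mulrBr !mulr1 mulrN.
move: (r1 * f1) (r2 * f2) b1 b2 => p1 p2 b1 b2.
rewrite !ler_norml.
move: (F * p1) (G * p2) => Fp Gp.
lra.
Qed.

(** Replacing $f$ by a constant $k$ in $\int f\,d\phi$ costs the oscillation
    of $f$ times the variation of $\phi$, which $\psi$ dominates. *)
Lemma Rintegral_derive_approx f phi dphi psi dpsi (a b k e : R) : a <= b ->
  0 <= e -> {within `[a, b], continuous f} ->
  (forall x : R, is_derive x 1 phi (dphi x)) -> continuous dphi ->
  (forall x : R, is_derive x 1 psi (dpsi x)) -> continuous dpsi ->
  (forall x, `|dphi x| <= dpsi x) ->
  (forall x, a <= x <= b -> `|f x - k| <= e) ->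
  `|Rintegral mu `[a, b]%classic (fun x => f x * dphi x) - k * (phi b - phi a)|
    <= e * (psi b - psi a).
Proof.
move=> ab e0 cf Dphi cphi Dpsi cpsi phipsi fk.
have wc (g : R -> R) : continuous g -> {within `[a, b], continuous g}.
  by move=> cg; exact: continuous_subspaceT.
have integ (g : R -> R) : {within `[a, b], continuous g} ->
    mu.-integrable `[a, b]%classic (EFin \o g).
  by apply: continuous_compact_integrable; exact: segment_compact.
have cfp : {within `[a, b], continuous (fun x => f x * dphi x)}.
  by move=> x; apply: continuousM; [exact: cf|exact: wc].
have ckp : {within `[a, b], continuous (fun x => k * dphi x)}.
  by move=> x; apply: continuousM; [exact: cst_continuous|exact: wc].
rewrite -(Rintegral_is_derive ab (fun x _ => Dphi x) (wc _ cphi)).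
rewrite -(Rintegral_is_derive ab (fun x _ => Dpsi x) (wc _ cpsi)).
rewrite -!RintegralZl//; try exact/integ/wc.
rewrite -RintegralB//; try exact: integ.
have idiff : mu.-integrable `[a, b]%classic
    (EFin \o (fun x => f x * dphi x - k * dphi x)).
  by apply: integ => x; exact: (continuousB (cfp x) (ckp x)).
apply: le_trans; first exact: le_normr_Rintegral.
apply: le_Rintegral => //.
- exact: integrable_norm.
- by apply: integ => x; apply: continuousM; [exact: cst_continuous|exact: wc].
- move=> x /=; rewrite in_itv/= => xab.
  by rewrite -mulrBl normrM ler_pM// fk.
Qed.

Let one : {poly R} := 1.

Lemma flat1_itv (y : R) : 0 <= flat one y <= 1.
Proof.
have [y0|y0] := leP y 0; first by rewrite flat_le0// lexx ler01.
rewrite flat_gt0// hornerC mul1r expR_ge0/= expR_le1 oppr_le0 invr_ge0.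
exact: ltW.
Qed.

Lemma flat1_ge (y : R) : 0 < y -> 1 - y^-1 <= flat one y.
Proof.
by move=> y0; rewrite flat_gt0// hornerC mul1r; exact: expR_ge1Dx.
Qed.

Let dflat1 := flat ('X^2 * (one - one^`())).

Lemma dflat1_ge0 (y : R) : 0 <= dflat1 y.
Proof.
rewrite /dflat1; have [y0|y0] := leP y 0; first by rewrite flat_le0.
rewrite flat_gt0// mulr_ge0 ?expR_ge0//.
rewrite hornerM hornerXn derivC subr0 hornerC mulr1.
by rewrite exprn_ge0// invr_ge0 ltW.
Qed.

Lemma continuous_flat (P : {poly R}) : continuous (flat P).
Proof. by move=> x; exact: is_derive1_continuous (is_derive_flat P x). Qed.

Variables (s t : R).

(** The shift by $1$ in the argument of each step makes it vanish up to
    $s + 1/n$, respectively from $t - 1/n$ on: for $n \ge 1$ the hat is then a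
    test function on every open interval that contains $]s, t[$, even one with
    the same ends. *)
Definition rise (n : nat) (x : R) := flat one (n%:R * x + (- (n%:R * s) - 1)).
Definition fall (n : nat) (x : R) := flat one (- n%:R * x + (n%:R * t - 1)).
Definition hat (n : nat) : R -> R := rise n * fall n.

Lemma rise_itv n x : 0 <= rise n x <= 1. Proof. exact: flat1_itv. Qed.
Lemma fall_itv n x : 0 <= fall n x <= 1. Proof. exact: flat1_itv. Qed.

Lemma smooth_hat n : smooth (hat n).
Proof.
by move=> k; apply: differentiable_timesM;
  apply: differentiable_times_comp_affine; exact: smooth_flat.
Qed.

Let drise n x := n%:R * dflat1 (n%:R * x + (- (n%:R * s) - 1)).
Let dfall n x := - n%:R * dflat1 (- n%:R * x + (n%:R * t - 1)).

Let is_derive_rise n (x : R) : is_derive x 1 (rise n) (drise n x).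
Proof. exact/is_derive_comp_affine/is_derive_flat. Qed.

Let is_derive_fall n (x : R) : is_derive x 1 (fall n) (dfall n x).
Proof. exact/is_derive_comp_affine/is_derive_flat. Qed.

Definition dhat n (x : R) := rise n x * dfall n x + fall n x * drise n x.

Lemma is_derive_hat n (x : R) : is_derive x 1 (hat n) (dhat n x).
Proof. exact: (is_deriveM (is_derive_rise n x) (is_derive_fall n x)). Qed.

Lemma derive1_hat n : derive1 (hat n) = dhat n.
Proof.
by apply/funext => x; rewrite derive1E; case: (is_derive_hat n x).
Qed.

Lemma continuous_dhat n : continuous (dhat n).
Proof.
move=> x; rewrite -derive1_hat.
apply/differentiable_continuous/derivable1_diffP.
exact: (@smooth_derivable_derive1n _ (hat n) 1 x (smooth_hat n)).
Qed.

(** An increasing function whose derivative dominates that of [hat n]. *)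
Let variation n : R -> R := rise n - fall n.
Let dvariation n x := drise n x - dfall n x.

Let is_derive_variation n (x : R) :
  is_derive x 1 (variation n) (dvariation n x).
Proof. exact: (is_deriveB (is_derive_rise n x) (is_derive_fall n x)). Qed.

Let continuous_dvariation n : continuous (dvariation n).
Proof.
have aff (m d : R) : continuous (fun x => m * dflat1 (m * x + d)).
  have [df _] : differentiable_times 1 (cst m * (fun x => dflat1 (m * x + d))).
    apply: differentiable_timesM; first exact: differentiable_times_cst.
    exact/differentiable_times_comp_affine/smooth_flat.
  by move=> x; exact/differentiable_continuous/derivable1_diffP/df.
by move=> x; exact: (continuousB (aff _ _ x) (aff _ _ x)).
Qed.

Let dhat_le n x : `|dhat n x| <= dvariation n x.
Proof.
have /andP[r0 r1] := rise_itv n x; have /andP[f0 f1] := fall_itv n x.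
have dr0 : 0 <= drise n x by rewrite mulr_ge0// dflat1_ge0.
have df0 : dfall n x <= 0 by rewrite mulr_le0_ge0 ?oppr_le0// dflat1_ge0.
rewrite /dhat /dvariation.
apply: (le_trans (ler_normD _ _)).
rewrite (normrM (rise n x)) (normrM (fall n x)) addrC.
rewrite (ger0_norm r0) (ger0_norm f0) (ger0_norm dr0) (ler0_norm df0).
by apply: lerD; rewrite ler_piMl// oppr_ge0.
Qed.

(** Outside shrinking neighbourhoods of $s$ and $t$ the hat is constant up to
    a small error, so its derivative tends to the difference of the Dirac
    masses at $s$ and $t$. *)
Lemma cvg_Rintegral_dhat f : s < t -> {within `[s, t], continuous f} ->
  Rintegral mu `[s, t]%classic (fun x => f x * dhat n x) @[n --> \oo]
    --> f s - f t.
Proof.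
move=> st cf.
have [M M0 fM] : exists2 M, 0 < M & forall x, s <= x <= t -> `|f x| <= M.
  have cnf : {within `[s, t], continuous (fun x => `|f x|)}.
    by move=> x; apply: continuous_comp; [exact: cf|exact: norm_continuous].
  have [c _ hc] := EVT_max (ltW st) cnf.
  exists (`|f c| + 1) => [|x xst]; first by rewrite ltr_wpDl.
  by rewrite (le_trans (hc x _))// lerDl.
apply/cvgrPdist_le => /= e0 e00.
(* [10] is the constant of [concentration_le]. *)
pose e := e0 / 10; have e_gt0 : 0 < e by rewrite divr_gt0.
have [d d0 [dst ds dt]] : exists2 d, 0 < d & [/\ s + d < t - d,
    forall x, s <= x <= s + d -> `|f x - f s| <= e &
    forall x, t - d <= x <= t -> `|f x - f t| <= e].
  have sst : s <= s <= t by rewrite lexx ltW.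
  have tst : s <= t <= t by rewrite lexx ltW.
  have [d1 d1_gt0 hd1] := within_itv_dist cf sst e_gt0.
  have [d2 d2_gt0 hd2] := within_itv_dist cf tst e_gt0.
  pose m := Num.min (Num.min d1 d2) ((t - s) / 2).
  have m0 : 0 < m by rewrite !lt_min d1_gt0 d2_gt0 divr_gt0// subr_gt0.
  have : m <= m by [].
  rewrite {2}/m !le_min => /andP[/andP[m1 m2] m3].
  exists (m / 2); first by lra.
  split; first by lra.
  - move=> x /andP[sx xs]; apply: hd1; first by apply/andP; lra.
    by rewrite ger0_norm; lra.
  - move=> x /andP[tx xt]; apply: hd2; first by apply/andP; lra.
    by rewrite ler0_norm; lra.
have Me0 : 0 < M / e by rewrite divr_gt0.
near=> n.
have nd : M / e + 1 <= n%:R * d.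
  by rewrite -ler_pdivrMr//; near: n; exact: nbhs_infty_ger.
have step z : M / e <= z -> 1 - e / M <= flat one z.
  move=> ez; have z0 := lt_le_trans Me0 ez.
  apply: le_trans (flat1_ge z0); rewrite lerD2l lerN2 -(invf_div M).
  by rewrite lef_pV2.
have rise_ge x : s + d <= x -> 1 - e / M <= rise n x.
  move=> sdx; apply: step.
  have : n%:R * d <= n%:R * (x - s) by rewrite ler_wpM2l//; lra.
  by rewrite mulrBr; lra.
have fall_ge x : x <= t - d -> 1 - e / M <= fall n x.
  move=> xtd; apply: step.
  have : n%:R * d <= n%:R * (t - x) by rewrite ler_wpM2l//; lra.
  by rewrite mulrBr mulNr; lra.
pose g x := f x * dhat n x.
have cg : {within `[s, t], continuous g}.
  move=> x; apply: continuousM; first exact: cf.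
  exact: (continuous_subspaceT (@continuous_dhat n)).
have sub a b : s <= a -> b <= t -> {within `[a, b], continuous f}.
  move=> sa bt; apply: continuous_subspaceW cf.
  by apply: subset_itv; rewrite bnd_simp.
have approx a b k e' := @Rintegral_derive_approx f (hat n) (dhat n)
  (variation n) (dvariation n) a b k e'.
have {approx} approx a b k e' : s <= a -> a <= b -> b <= t -> 0 <= e' ->
    (forall x, a <= x <= b -> `|f x - k| <= e') ->
    `|Rintegral mu `[a, b]%classic g - k * (hat n b - hat n a)|
      <= e' * (variation n b - variation n a).
  move=> sa ab bt e'0; apply: approx => //.
  - exact: sub.
  - exact: is_derive_hat.
  - exact: continuous_dhat.
have sd : s <= s + d by lra.
have td : t - d <= t by lra.
have -> : Rintegral mu `[s, t]%classic g =
    Rintegral mu `[s, s + d]%classic g +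
    (Rintegral mu `[s + d, t - d]%classic g +
     Rintegral mu `[t - d, t]%classic g).
  have ig a b : s <= a -> b <= t -> mu.-integrable `[a, b]%classic (EFin \o g).
    move=> sa bt; apply: continuous_compact_integrable; first exact: segment_compact.
    by apply: continuous_subspaceW cg; apply: subset_itv; rewrite bnd_simp.
  rewrite (Rintegral_itv_cat sd _ (ig _ _ (lexx s) (lexx t))); last by lra.
  by congr (_ + _); exact: (Rintegral_itv_cat (ltW dst) td (ig _ _ sd (lexx t))).
(* Near the ends $f$ is close to its end values; in the middle it is merely
   bounded by $M$, but there the steps vary by at most $e/M$. *)
have I1 := approx s (s + d) (f s) e (lexx s) sd _ (ltW e_gt0) ds.
have I2 := approx (s + d) (t - d) 0 M sd (ltW dst) td (ltW M0) _.
have I3 := approx (t - d) t (f t) e _ td (lexx t) (ltW e_gt0) dt.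
have {}I1 := I1 ltac:(lra).
have {}I3 := I3 ltac:(lra).
have {}I2 := I2 ltac:(move=> x xsd; rewrite subr0 fM//; lra).
have fs_le : `|f s| <= M by apply: fM; lra.
have ft_le : `|f t| <= M by apply: fM; lra.
have eta : M * (e / M) = e by rewrite mulrC divfK// gt_eqF.
have eE : 10 * e = e0 by rewrite /e mulrC divfK.
rewrite -eE; apply: (@concentration_le e M (e / M) (f s) (f t) _ _ _
  (rise n s) (fall n s) (rise n (s + d)) (fall n (s + d))
  (rise n (t - d)) (fall n (t - d)) (rise n t) (fall n t)
  _ _ _ eta fs_le ft_le I1 I2 I3); rewrite ?rise_itv ?fall_itv//.
- exact: ltW.
- exact: ltW.
- by rewrite ltW// divr_gt0.
- by rewrite /rise flat_le0 ?mul0r//; lra.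
- by rewrite /fall flat_le0 ?mulr0//; lra.
- exact/rise_ge.
- exact/rise_ge/ltW.
- exact/fall_ge/ltW.
- exact/fall_ge.
Unshelve. all: by end_near. Qed.

End Hat.

(** * Continuous functions are primitives of their weak derivatives *)

Section WeakDerivative.
Context {R : realType}.
Local Notation mu := (@lebesgue_measure R).
Implicit Types f g : R -> R.

Lemma hat_itv (s t : R) n x : 0 <= hat s t n x <= 1.
Proof.
have /andP[r0 r1] := rise_itv s n x; have /andP[f0 f1] := fall_itv t n x.
by rewrite mulr_ge0//= mulr_ile1.
Qed.

Lemma rise_eq0 (s : R) n x : x <= s + n%:R^-1 -> rise s n x = 0.
Proof.
move=> xs; rewrite /rise flat_le0//.
have [->|n0] := posnP n; first by rewrite mul0r mul0r; lra.
have : n%:R * x <= n%:R * (s + n%:R^-1) by rewrite ler_wpM2l.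
by rewrite mulrDr divff ?pnatr_eq0 -?lt0n//; lra.
Qed.

Lemma fall_eq0 (t : R) n x : t - n%:R^-1 <= x -> fall t n x = 0.
Proof.
move=> xt; rewrite /fall flat_le0//.
have [->|n0] := posnP n; first by rewrite oppr0 mul0r mul0r; lra.
have : n%:R * (t - n%:R^-1) <= n%:R * x by rewrite ler_wpM2l.
by rewrite mulrBr divff ?pnatr_eq0 -?lt0n// mulNr; lra.
Qed.

Lemma hat_test_function (a b s t : R) n : (0 < n)%N -> a <= s -> t <= b ->
  test_function a b (hat s t n).
Proof.
move=> n0 sa tb; have ni : (0 : R) < n%:R^-1 by rewrite invr_gt0 ltr0n.
split; first by move=> k x; exact/smooth_derivable_derive1n/smooth_hat.
exists (s + n%:R^-1), (t - n%:R^-1); split; [lra|lra|move=> x].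
rewrite in_itv/= negb_and -!ltNge => /orP[xs|xt].
  by rewrite /hat /= /GRing.mul/= rise_eq0 ?mul0r// ltW.
by rewrite /hat /= /GRing.mul/= fall_eq0 ?mulr0// ltW.
Qed.

Lemma dhat_eq0 (s t : R) n x : ~~ (s < x < t) -> dhat s t n x = 0.
Proof.
rewrite negb_and -!leNgt => /orP[xs|tx]; rewrite /dhat.
  rewrite rise_eq0 ?mul0r ?add0r; last first.
    by rewrite (le_trans xs)// lerDl invr_ge0.
  rewrite (@flat_le0 _ _ (_ + _)) ?mulr0 ?mulr0//.
  have : n%:R * x <= n%:R * s by rewrite ler_wpM2l.
  by lra.
rewrite fall_eq0 ?mul0r ?addr0; last first.
  by rewrite (le_trans _ tx)// gerBl invr_ge0.
rewrite (@flat_le0 _ _ (_ + _)) ?mulr0 ?mulr0// mulNr.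
have : n%:R * t <= n%:R * x by rewrite ler_wpM2l.
lra.
Qed.

Lemma cvg_step (d : R) : 0 < d ->
  flat (1 : {poly R}) (n%:R * d - 1) @[n --> \oo] --> (1 : R).
Proof.
move=> d0; apply/cvgrPdist_le => /= e e0; near=> n.
have /andP[_ fle] := flat1_itv (n%:R * d - 1).
rewrite ger0_norm ?subr_ge0// lerBlDr -lerBlDl.
have nd : e^-1 + 1 <= n%:R * d.
  by rewrite -ler_pdivrMr//; near: n; exact: nbhs_infty_ger.
have ei : 0 < e^-1 by rewrite invr_gt0.
have z0 : 0 < n%:R * d - 1 by lra.
apply: le_trans (flat1_ge z0); rewrite lerD2l lerN2 -[leRHS]invrK.
by rewrite lef_pV2 ?posrE//; lra.
Unshelve. all: by end_near. Qed.

Lemma cvg_hat (s t x : R) :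
  hat s t n x @[n --> \oo] --> (\1_(`]s, t[%classic) x : R).
Proof.
rewrite indicE; have [xst|xst] := boolP (s < x < t).
  rewrite mem_set/= ?in_itv//; move: xst => /andP[sx xt].
  have cr : rise s n x @[n --> \oo] --> (1 : R).
    have xs0 : 0 < x - s by rewrite subr_gt0.
    apply: cvg_trans (cvg_step xs0).
    by apply: near_eq_cvg; apply: nearW => n; rewrite /rise; congr flat; ring.
  have cf : fall t n x @[n --> \oo] --> (1 : R).
    have tx0 : 0 < t - x by rewrite subr_gt0.
    apply: cvg_trans (cvg_step tx0).
    by apply: near_eq_cvg; apply: nearW => n; rewrite /fall; congr flat; ring.
  have cfr := cvgM cr cf; rewrite mulr1 in cfr; exact: cfr.
rewrite memNset/= ?in_itv//; last exact/negP.
apply: cvg_near_cst; apply: nearW => n.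
move: xst; rewrite negb_and -!leNgt => /orP[xs|tx];
  rewrite -[LHS]/(rise s n x * fall t n x).
  by rewrite rise_eq0 ?mul0r// (le_trans xs)// lerDl invr_ge0.
by rewrite fall_eq0 ?mulr0// (le_trans _ tx)// gerBl invr_ge0.
Qed.

(** Tested against the hats, the defining identity of the weak derivative
    tends to $f(s) - f(t) = - \int_s^t g$. The ends $s = a$ and $t = b$ are
    allowed, which gives increments up to the final time. *)
Lemma weak_derivative_primitive (a b s t : R) f g :
  {within `[a, b], continuous f} ->
  mu.-integrable `]a, b[%classic (EFin \o g) -> is_weak_derivative a b f g ->
  a <= s -> s < t -> t <= b ->
  Rintegral mu `]s, t[%classic g = f t - f s.
Proof.
move=> cf ig fg sa st tb.
have mab : measurable (`]a, b[%classic : set (measurableTypeR R)) by [].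
have cfst : {within `[s, t], continuous f}.
  by apply: continuous_subspaceW cf; apply: subset_itv; rewrite bnd_simp.
have lhs := cvg_Rintegral_dhat st cfst.
have rhs : Rintegral mu `]a, b[%classic (fun x => g x * hat s t n x)
    @[n --> \oo] --> Rintegral mu `]s, t[%classic g.
  have -> : Rintegral mu `]s, t[%classic g =
      Rintegral mu `]a, b[%classic (fun x => g x * \1_(`]s, t[%classic) x).
    rewrite Rintegral_mkcond [RHS]Rintegral_mkcond; apply: eq_Rintegral => x _.
    rewrite !patchE indicE; case: ifPn => xst; last by rewrite mulr0 if_same.
    rewrite mulr1 ifT//; move: xst; rewrite !inE/= !in_itv/= => /andP[sx xt].
    by rewrite (le_lt_trans sa)// (lt_le_trans xt).
  have mhat n : measurable_fun `]a, b[%classic (hat s t n).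
    apply: measurable_funTS; apply: continuous_measurable_fun => x.
    exact: is_derive1_continuous (is_derive_hat s t n x).
  have mg : measurable_fun `]a, b[%classic g.
    by apply/measurable_EFinP; exact: measurable_int ig.
  apply: fine_cvg; rewrite fineK; last first.
    apply: integrable_fin_num => //; apply: le_integrable ig => //.
      apply/measurable_EFinP; apply: measurable_funM => //.
    move=> x _ /=; rewrite lee_fin normrM ler_piMr// indicE.
    by case: (_ \in _); rewrite ?normr0 ?normr1.
  have := @dominated_convergence _ _ _ mu `]a, b[%classic mab
    (fun n x => (g x * hat s t n x)%:E)
    (fun x => (g x * \1_(`]s, t[%classic) x)%:E)
    (fun x => `|g x|%:E).
  case.
  - by move=> n; apply/measurable_EFinP; exact: (measurable_funM mg (mhat n)).
  - by apply/measurable_EFinP; exact: measurable_funM.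
  - apply: aeW => x _; apply: cvg_EFin; first exact: nearW.
    by apply: cvgM; [exact: cvg_cst|exact: cvg_hat].
  - exact: integrable_norm ig.
  - apply: aeW => x n _ /=; rewrite lee_fin normrM ler_piMr//.
    by have /andP[b0 b1] := hat_itv s t n x; rewrite ger0_norm.
  by move=> _ _.
have eqn : \forall n \near \oo,
    Rintegral mu `[s, t]%classic (fun x => f x * dhat s t n x) =
    - Rintegral mu `]a, b[%classic (fun x => g x * hat s t n x).
  near=> n; have n0 : (0 < n)%N by near: n; exact: nbhs_infty_gt.
  rewrite -(fg _ (hat_test_function n0 sa tb)) derive1_hat.
  rewrite Rintegral_mkcond [RHS]Rintegral_mkcond; apply: eq_Rintegral => x _.
  rewrite !patchE.
  have [xst|xst] := boolP (s < x < t).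
    move: (xst) => /andP[sx xt]; rewrite !mem_set//= in_itv/=.
      by rewrite (le_lt_trans sa)// (lt_le_trans xt).
    by rewrite !ltW.
  by rewrite dhat_eq0 ?mulr0 ?if_same.
have : f s - f t = - Rintegral mu `]s, t[%classic g.
  apply: (cvg_unique _ lhs) => //.
  apply: cvg_trans (cvgN rhs); apply: near_eq_cvg; near=> n.
  by apply/esym; near: n.
lra.
Unshelve. all: by end_near. Qed.

End WeakDerivative.

(** * Integrals against a monotone weight *)

Section WeightedIntegral.
Context {R : realType}.
Local Notation mu := (@lebesgue_measure R).
Implicit Types k g : R -> R.

(** Being up-closed, $U$ is $]s, b[$ or $[s, b[$ with $s$ its infimum. *)
Lemma Rintegral_upset_ge0 (a b : R) g (U : set R) :
  U `<=` `]a, b[%classic ->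
  (forall x y, U x -> x <= y -> y < b -> U y) ->
  mu.-integrable `]a, b[%classic (EFin \o g) ->
  (forall s, a <= s < b -> 0 <= Rintegral mu `]s, b[%classic g) ->
  0 <= Rintegral mu U g.
Proof.
move=> Uab Uup ig tails.
have [U0|/set0P [x0 Ux0]] := eqVneq U set0; first by rewrite U0 Rintegral_set0.
have Ulb x : U x -> a < x < b by move=> /Uab; rewrite /= in_itv.
have hU : has_inf U.
  by split; [exists x0|exists a => x /Ulb/andP[/ltW]].
pose s := inf U.
have sb : a <= s < b.
  rewrite lb_le_inf//=; last by move=> x /Ulb/andP[/ltW].
    by apply: le_lt_trans (ge_inf hU.2 Ux0) _; case/andP: (Ulb _ Ux0).
  by exists x0.
have Us y : s < y -> y < b -> U y.
  move=> sy yb; have ys0 : 0 < y - s by rewrite subr_gt0.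
  have [x Ux] := inf_adherent ys0 hU; rewrite subrKC => xy.
  exact: Uup Ux (ltW xy) yb.
have sU y : U y -> s <= y by move=> Uy; exact: (ge_inf hU.2 Uy).
have [Uss|Uss] := pselect (U s).
  have -> : U = `[s, b[%classic.
    apply/seteqP; split => y /=; rewrite in_itv/=.
      by move=> Uy; rewrite sU//=; case/andP: (Ulb _ Uy).
    by move=> /andP[sy yb]; exact: Uup sy yb.
  rewrite -Rintegral_itv_obnd_cbnd; first exact: tails.
  apply: integrableS ig => //; apply: subset_itvr; rewrite bnd_simp.
  by case/andP: sb.
have -> : U = `]s, b[%classic.
  apply/seteqP; split => y /=; rewrite in_itv/=.
    move=> Uy; rewrite lt_neqAle sU// andbT; apply/andP; split.
      by apply/eqP => sy; apply: Uss; rewrite sy.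
    by case/andP: (Ulb _ Uy).
  by move=> /andP[]; exact: Us.
exact: tails.
Qed.

(** Layer-cake formula: $k - c$ is the superposition of the indicators of its
    superlevel sets, and a superlevel set of a nondecreasing function is a
    final segment, over which $g$ has a nonnegative integral. *)
Lemma Rintegral_nondecreasing_ge (a b c : R) k g :
  (forall x y, a < x -> x <= y -> y < b -> k x <= k y) ->
  (forall x, a < x < b -> c <= k x) ->
  measurable_fun `]a, b[%classic k ->
  mu.-integrable `]a, b[%classic (EFin \o g) ->
  mu.-integrable `]a, b[%classic (fun x => (k x * g x)%:E) ->
  (forall s, a <= s < b -> 0 <= Rintegral mu `]s, b[%classic g) ->
  c * Rintegral mu `]a, b[%classic g <=
  Rintegral mu `]a, b[%classic (fun x => k x * g x).
Proof.
move=> kmono kc mk ig ikg tails.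
have mI : measurable (`]a, b[%classic : set (measurableTypeR R)) by [].
pose G : measurableTypeR R -> R := g \_ `]a, b[%classic.
pose K : measurableTypeR R -> R := (fun x => k x - c) \_ `]a, b[%classic.
have mg : measurable_fun `]a, b[%classic g.
  by apply/measurable_EFinP; exact: measurable_int ig.
have mG : measurable_fun setT G by exact/(measurable_restrictT _ _).1.
have mK : measurable_fun setT K.
  by apply/(measurable_restrictT _ _).1 => //; exact: measurable_funB.
have K0 x : 0 <= K x.
  rewrite /K patchE; case: ifPn => //; rewrite inE/= in_itv/= => xab.
  by rewrite subr_ge0 kc.
(* The indicator of $0 < y < K(x)$ is written as a product, whose measurability
   is that of its factors; its integral over the level $y$ is $K(x)$. *)
pose f (z : measurableTypeR R * measurableTypeR R) : \bar R :=
  (G z.1 *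
    (\1_(`]0, +oo[%classic) z.2 * \1_(`]0, +oo[%classic) (K z.1 - z.2)))%:E.
have mf : measurable_fun setT f.
  have m1 : measurable_fun setT (\1_(`]0, +oo[%classic) : R -> R) by [].
  have mK1 : measurable_fun setT
      (fun z : measurableTypeR R * measurableTypeR R => K z.1 - z.2).
    apply: measurable_funB; last exact: measurable_snd.
    exact: measurableT_comp mK measurable_fst.
  apply/measurable_EFinP; apply: measurable_funM.
    exact: measurableT_comp mG measurable_fst.
  apply: measurable_funM; first exact: measurableT_comp m1 measurable_snd.
  exact: measurableT_comp m1 mK1.
have section (h : R) x :
    (\int[mu]_y ((h * (\1_(`]0%R, +oo[%classic) y *
       \1_(`]0%R, +oo[%classic) (K x - y)))%:E) = (h * K x)%:E)%E.
  transitivity (\int[mu]_(y in `]0%R, K x[%classic) h%:E)%E.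
    rewrite [RHS]integral_mkcond; apply: eq_integral => y _.
    rewrite patchE !indicE !mem_setE !in_itv/= !andbT subr_gt0.
    by case: ltP => _; case: ltP => _; rewrite ?mulr1 ?mulr0.
  rewrite integral_cst//= lebesgue_measure_itv/= lte_fin.
  case: ltP => [_|K0']; first by rewrite -EFinB subr0 -EFinM.
  have -> : K x = 0 by apply/eqP; rewrite eq_le K0 K0'.
  by rewrite mule0 mulr0.
have ikc : mu.-integrable `]a, b[%classic (fun x => (g x * (k x - c))%:E).
  have := integrableB mI ikg (integrableZl mI c ig).
  apply: eq_integrable => // x _ /=; congr EFin; ring.
have GK x : G x * K x = ((fun x => g x * (k x - c)) \_ `]a, b[%classic) x.
  by rewrite /G /K !patchE; case: ifPn; rewrite ?mulr0.
have iGK : mu.-integrable setT (fun x => (G x * K x)%:E).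
  have := (integrable_mkcond _ mI).1 ikc; apply: eq_integrable => // x _ /=.
  by rewrite GK !patchE; case: ifPn.
have abs12 : (\int[mu]_x \int[mu]_y `|f (x, y)| < +oo)%E.
  have [_ ] := integrableP _ _ _ iGK; apply: le_lt_trans.
  rewrite le_eqVlt; apply/orP; left; apply/eqP/eq_integral => x _.
  rewrite /= normrM (ger0_norm (K0 x)) -section; apply: eq_integral => y _.
  rewrite /f /= normrM; congr (_ * _)%:E; rewrite ger0_norm// mulr_ge0//.
have intf : (mu \x mu)%E.-integrable setT f by exact/integrable12ltyP.
have GK0 : 0 <= Rintegral mu `]a, b[%classic (fun x => g x * (k x - c)).
  have -> : Rintegral mu `]a, b[%classic (fun x => g x * (k x - c)) =
      fine (\int[mu]_x (G x * K x)%:E)%E.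
    rewrite Rintegral_mkcond; congr fine; apply: eq_integral => x _.
    by rewrite GK.
  under eq_integral do rewrite -section.
  have := Fubini intf; rewrite /f/= => ->.
  apply: fine_ge0; apply: integral_ge0 => y _.
  have [y0|y0] := leP y 0.
    rewrite integral0_eq// => x _.
    by rewrite indicE memNset/= ?in_itv/= ?andbT ?mul0r ?mulr0// ltNge y0.
  (* A superlevel set at a positive level lies in $]a, b[$, as $K$ is zero
     outside. *)
  pose U := K @^-1` `]y, +oo[%classic.
  have mU : measurable (U : set (measurableTypeR R)).
    by rewrite -[U]setTI; exact: mK.
  have UI : U `<=` `]a, b[%classic.
    move=> x; rewrite /U/= in_itv/= andbT /K patchE.
    by case: ifPn => [/set_mem//|_ yx]; move: (lt_trans y0 yx); rewrite ltxx.
  have igU : mu.-integrable U (EFin \o g) by exact: integrableS ig.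
  have gU : 0 <= Rintegral mu U g.
    apply: Rintegral_upset_ge0 ig tails => //.
    move=> x z Ux xz zb; have := UI _ Ux; rewrite /= in_itv/= => /andP[ax xb].
    have az := lt_le_trans ax xz.
    move: Ux; rewrite /U/= !in_itv/= !andbT /K !patchE !mem_set/=; last 2 first.
    - by rewrite in_itv/= az.
    - by rewrite in_itv/= ax.
    by move=> /lt_le_trans; apply; rewrite lerD2r kmono.
  have -> : (\int[mu]_x (G x * (\1_(`]0%R, +oo[%classic) y *
      \1_(`]0%R, +oo[%classic) (K x - y)))%:E = \int[mu]_(x in U) (g x)%:E)%E.
    rewrite [RHS]integral_mkcond; apply: eq_integral => x _.
    rewrite patchE !indicE mem_set/= ?in_itv/= ?y0// mul1r.
    have [xU|xU] := boolP (x \in U).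
      have Ux := set_mem xU.
      rewrite /G patchE (mem_set (UI _ Ux)) mem_set ?mulr1//=.
      by move: Ux; rewrite /U/= !in_itv/= !andbT subr_gt0.
    rewrite memNset ?mulr0//= in_itv/= andbT subr_gt0 => yx.
    by move/negP: xU; apply; rewrite inE /U/= in_itv/= yx.
  rewrite -[leRHS]fineK ?lee_fin//; exact: integrable_fin_num.
have : Rintegral mu `]a, b[%classic (fun x => g x * (k x - c)) =
    Rintegral mu `]a, b[%classic (fun x => k x * g x) -
    c * Rintegral mu `]a, b[%classic g.
  rewrite -RintegralZl// -RintegralB//; last exact: integrableZl ig.
  by apply: eq_Rintegral => x _; ring.
by move=> GKE; rewrite GKE subr_ge0 in GK0.
Qed.

End WeightedIntegral.

(** * The Laplacian at an interior maximum *)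

Section SecondDerivativeTest.
Context {R : realType}.

(** If $l > 0$ then $q'$ is positive just to the right of $0$, so $q$ exceeds
    $q(0)$ there. *)
Lemma second_derivative_at_max (q q1 : R -> R) (l d : R) : 0 < d ->
  (forall r : R, `|r| < d -> is_derive r 1 q (q1 r)) ->
  is_derive (0 : R) 1 q1 l ->
  (forall r, `|r| < d -> q r <= q 0) -> l <= 0.
Proof.
move=> d0 dq dq1 qmax; have near0 (r : R) : r \in `]- d, d[ -> `|r| < d.
  by rewrite in_itv/= ltr_norml.
have q10 : q1 0 = 0.
  have q00 : is_derive (0 : R) 1 q 0.
    apply: (@derive1_at_max _ q (- d) d) => //.
    - by lra.
    - by move=> r /near0/dq[].
    - by rewrite in_itv/=; lra.
    - by move=> r /near0/qmax.
  have [_ <-] : is_derive (0 : R) 1 q (q1 0) by apply: dq; rewrite normr0.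
  by case: q00.
have /is_derive1_caratheodory[g [gE cg g0]] := dq1.
rewrite leNgt; apply/negP => l0.
have : \forall z \near (0 : R), 0 < g z.
  by apply: (cvgr_gt (g 0) cg); rewrite g0.
move=> /nbhs_ballP[e /= e0 he].
pose r := Num.min d e / 2.
have m0 : 0 < Num.min d e by rewrite lt_min d0 e0.
have [rd re] : r < d /\ r < e.
  have [md me] : Num.min d e <= d /\ Num.min d e <= e.
    by rewrite !ge_min !lexx orbT.
  by rewrite /r; split; lra.
have r0 : 0 < r by rewrite divr_gt0.
have dqr x : x \in `]0, r[ -> is_derive x 1 q (q1 x).
  by rewrite in_itv/= => /andP[x0 xr]; apply: dq; rewrite gtr0_norm//; lra.
have [|c] := MVT r0 dqr.
  apply: derivable_within_continuous => x; rewrite in_itv/= => /andP[x0 xr].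
  have : is_derive x 1 q (q1 x) by apply: dq; rewrite ger0_norm//; lra.
  by case.
rewrite in_itv/= => /andP[c0 cr] qr.
have : 0 < g c by apply: he; rewrite /ball/= sub0r normrN gtr0_norm//; lra.
have := gE c; rewrite q10 !subr0 => q1c gc.
have : q r <= q 0 by apply: qmax; rewrite gtr0_norm.
rewrite -subr_le0 qr subr0 q1c leNgt => /negP; apply.
by rewrite !mulr_gt0.
Qed.

Lemma is_derive_line (n : nat) (f : 'rV[R]_n -> R) (x e : 'rV[R]_n) (r : R) :
  derivable f (r *: e + x) e ->
  is_derive r 1 (fun h => f (h *: e + x)) ('D_e f (r *: e + x)).
Proof.
move=> df.
pose F (h : R) := f (h *: e + x).
have E : (fun h : R => h^-1 *: ((F \o shift r) (h *: 1) - F r)) =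
    (fun h : R => h^-1 *: ((f \o shift (r *: e + x)) (h *: e) - f (r *: e + x))).
  by apply/funext => h; rewrite /F /= [h *: 1]mulr1 scalerDl addrA.
by split; [move: df; rewrite /derivable -E|rewrite /derive -E].
Qed.

(** The second derivative test applies to $f - g$ along each coordinate
    line. *)
Lemma laplacian_sub_at_max (n : nat) (G : set 'rV[R]_n) (f g : 'rV[R]_n -> R)
  (x : 'rV[R]_n) : open G -> G x -> Ck_open 2 G f -> Ck_open 2 G g ->
  (forall y, G y -> f y - g y <= f x - g x) -> laplacian f x <= laplacian g x.
Proof.
move=> oG Gx Cf Cg fgmax; apply: ler_sum => i _.
pose e : 'rV[R]_n := delta_mx 0 i.
have dE h : Ck_open 2 G h -> forall y, G y -> derivable h y e.
  by move=> /(_ [::] isT)[_ /(_ isT i)].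
have dE2 h : Ck_open 2 G h -> forall y, G y -> derivable ('D_e h) y e.
  by move=> /(_ [:: i] isT)[_ /(_ isT i)].
have nG : \forall y \near x, G y by exact: open_nbhs_nbhs.
have [d d0 hd] : exists2 d : R, 0 < d & forall r, `|r| < d -> G (r *: e + x).
  have cl : (r *: e + x) @[r --> (0 : R)] --> (0 : R) *: e + x.
    by apply: cvgD; [exact: scalel_continuous|exact: cvg_cst].
  have : \forall r \near (0 : R), G (r *: e + x).
    by apply: cl; rewrite scale0r add0r.
  move=> /nbhs_ballP[d d0 hd]; exists d => // r rd.
  by apply: hd; rewrite /ball/= sub0r normrN.
rewrite -subr_le0.
apply: (@second_derivative_at_max (fun r => f (r *: e + x) - g (r *: e + x))
   (fun r => 'D_e f (r *: e + x) - 'D_e g (r *: e + x)) _ d d0).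
- by move=> r rd; apply: is_deriveB; apply: is_derive_line; exact/dE/hd.
- have x0 : 0 *: e + x = x by rewrite scale0r add0r.
  have := is_deriveB (@is_derive_line _ ('D_e f) x e 0 _)
    (@is_derive_line _ ('D_e g) x e 0 _).
  by rewrite x0; apply; exact: dE2.
- by move=> r rd; rewrite scale0r add0r; exact/fgmax/hd.
Qed.

End SecondDerivativeTest.

(** * The Hadamard-type derivative at a maximum *)

Section HadamardExtremum.
Context {R : realType}.
Local Notation mu := (@lebesgue_measure R).

Lemma L2_itv_integrable (a b : R) (f : R -> R) :
  L2_itv a b f -> mu.-integrable `]a, b[%classic (EFin \o f).
Proof.
move=> [mf if2].
have i1 : mu.-integrable `]a, b[%classic (EFin \o cst (1 : R)).
  have : mu.-integrable `[a, b]%classic (EFin \o cst (1 : R)).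
    apply: continuous_compact_integrable; first exact: segment_compact.
    by apply: continuous_subspaceT => x; exact: cst_continuous.
  by apply: integrableS => //; exact: subset_itv_oo_cc.
have mab : measurable (`]a, b[%classic : set (measurableTypeR R)) by [].
have := integrableD mab i1 if2.
apply: le_integrable => //; first exact/measurable_EFinP.
move=> x _ /=; rewrite lee_fin; apply: le_trans (ler_norm _).
have [n1|n1] := leP `|f x| 1; first by rewrite (le_trans n1)// lerDl sqr_ge0.
rewrite ler_wpDl// -real_normK ?num_real// expr2 ler_peMr// ltW//.
Qed.

Lemma H1_itv_weak_derivative (a b : R) (f : R -> R) : H1_itv a b f ->
  mu.-integrable `]a, b[%classic (EFin \o weak_derivative a b f) /\
  is_weak_derivative a b f (weak_derivative a b f).
Proof.
move=> [_ [g Lg fg]].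
have [Lw fw] := @xgetPex _ (fun=> 0) [set g | L2_itv a b g /\
  is_weak_derivative a b f g] (ex_intro _ g (conj Lg fg)).
by split=> //; exact: L2_itv_integrable.
Qed.

Lemma hadamard_kernel_homo (alpha t x y : R) : 0 <= alpha ->
  0 < x -> x <= y -> y < t ->
  ln (t / x) `^ (- alpha) <= ln (t / y) `^ (- alpha).
Proof.
move=> a0 x0 xy yt; have y0 := lt_le_trans x0 xy.
have t0 := lt_trans y0 yt.
apply: powR_le_nonpos; last by rewrite oppr_le0.
  by rewrite ln_gt0// ltr_pdivlMr// mul1r.
by rewrite ler_ln ?posrE ?divr_gt0// ler_pM2l// lef_pV2.
Qed.

(** Extremum principle: where $w$ reaches its maximum over the past, its
    derivative of order $\alpha$ is at least what the smallest value of the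
    kernel gives for the total increment. *)
Lemma hadamard_kernel_extremum (alpha t : R) (w g : R -> R) : 0 <= alpha ->
  1 < t -> mu.-integrable `]1, t[%classic (EFin \o g) ->
  mu.-integrable `]1, t[%classic
    (fun s => (ln (t / s) `^ (- alpha) * g s)%:E) ->
  (forall s, 1 <= s < t -> Rintegral mu `]s, t[%classic g = w t - w s) ->
  (forall s, 1 <= s < t -> w s <= w t) ->
  ln t `^ (- alpha) * (w t - w 1) <=
  Rintegral mu `]1, t[%classic (fun s => ln (t / s) `^ (- alpha) * g s).
Proof.
move=> a0 t1 ig ikg gw wmax.
rewrite -gw ?lexx//; apply: Rintegral_nondecreasing_ge => //.
- by move=> x y x1 xy yt; apply: hadamard_kernel_homo => //; exact: lt_trans x1.
- move=> x /andP[x1 xt]; rewrite -[X in ln X](divr1 t).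
  by apply: hadamard_kernel_homo => //; exact: ltW.
- apply: (measurableT_comp (measurable_powR _)).
  apply: (eq_measurable_fun (fun s => ln t - ln s)).
    move=> s; rewrite inE/= in_itv/= => /andP[s1 st].
    by rewrite ln_div ?posrE//; lra.
  by apply: measurable_funB => //; apply: measurable_funTS.
- by move=> s s1; rewrite gw// subr_ge0 wmax.
Qed.

(** The derivative is defined from chosen representatives of the weak
    derivatives; they enter only through their integrals, which
    [weak_derivative_primitive] identifies with increments of $f_1$ and
    $f_2$. *)
Lemma hadamard_lt_at_max (alpha T t : R) (f1 f2 : R -> R) : 0 < alpha < 1 ->
  1 < t <= T ->
  {within `[1, T], continuous f1} -> {within `[1, T], continuous f2} ->
  H1_itv 1 T f1 -> H1_itv 1 T f2 ->
  hadamard_defined alpha T f1 t -> hadamard_defined alpha T f2 t ->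
  (forall s, 1 <= s < t -> f1 s - f2 s <= f1 t - f2 t) ->
  f1 1 - f2 1 < f1 t - f2 t ->
  hadamard alpha T f2 t < hadamard alpha T f1 t.
Proof.
move=> /andP[a0 a1] /andP[t1 tT] c1 c2 H1 H2 d1 d2 fmax f0.
have [i1 w1] := H1_itv_weak_derivative H1.
have [i2 w2] := H1_itv_weak_derivative H2.
set g1 := weak_derivative 1 T f1 in i1 w1 *.
set g2 := weak_derivative 1 T f2 in i2 w2 *.
have mI s : measurable (`]s, t[%classic : set (measurableTypeR R)) by [].
have sub s : 1 <= s -> (`]s, t[%classic : set R) `<=` `]1, T[%classic.
  by move=> s1; apply: subset_itv; rewrite bnd_simp.
have is1 s : 1 <= s -> mu.-integrable `]s, t[%classic (EFin \o g1).
  by move=> s1; apply: integrableS i1 => //; exact: sub.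
have is2 s : 1 <= s -> mu.-integrable `]s, t[%classic (EFin \o g2).
  by move=> s1; apply: integrableS i2 => //; exact: sub.
rewrite /hadamard -subr_gt0 -mulrBr.
have G0 : 0 < Gamma (1 - alpha) by apply: Gamma_gt0; lra.
rewrite mulr_gt0 ?invr_gt0//.
rewrite -RintegralB//.
have lnt : 0 < ln t `^ (- alpha) by rewrite powR_gt0// ln_gt0.
have pos : 0 < ln t `^ (- alpha) * ((f1 t - f2 t) - (f1 1 - f2 1)).
  by rewrite mulr_gt0// subr_gt0.
apply: (lt_le_trans pos).
under [leRHS]eq_Rintegral do rewrite /hadamard_integrand -mulrBr.
apply: (@hadamard_kernel_extremum _ _ (fun s => f1 s - f2 s)
  (fun s => g1 s - g2 s)) => //.
- exact: ltW.
- exact: (integrableB (mI 1) (is1 1 (lexx 1)) (is2 1 (lexx 1))).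
- have := integrableB (mI 1) d1 d2; apply: eq_integrable => // s _ /=.
  by rewrite -EFinB /hadamard_integrand -mulrBr.
- move=> s /andP[s1 st]; rewrite RintegralB; [|exact: mI|exact: is1|exact: is2].
  rewrite (weak_derivative_primitive c1 i1 w1 s1 st tT).
  rewrite (weak_derivative_primitive c2 i2 w2 s1 st tT).
  lra.
Qed.

End HadamardExtremum.

(** * Comparison of solutions *)

Section Comparison.
Context {R : realType}.

Lemma bounded_closure_compact (n : nat) (G : set 'rV[R]_n) :
  bounded_set G -> compact (closure G).
Proof.
move=> [M [Mreal GM]]; apply: bounded_closed_compact; last exact: closed_closure.
exists M; split=> // r Mr x Gx.
have cB : closed [set y : 'rV[R]_n | `|y| <= r].
  apply: (@closed_comp _ _ (@Num.norm _ 'rV[R]_n) [set y | y <= r]) => [y _|].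
    exact: norm_continuous.
  exact: closed_le.
by apply: cB; apply: closureS Gx => y Gy; exact: GM.
Qed.

(** At a positive maximum of $u - v$ the fractional derivative of $u$ exceeds
    that of $v$, while the right-hand side for $u$ is at most that for $v$. *)
Lemma solution_le (n : nat) (alpha nu T : R) (G : set 'rV[R]_n)
  (F : 'rV[R]_n -> R -> R -> R) (phi : 'rV[R]_n -> R)
  (psi : 'rV[R]_n -> R -> R) (u v : 'rV[R]_n -> R -> R) :
  0 < alpha < 1 -> 0 < nu -> open G -> bounded_set G ->
  (forall x t, closure G x -> 1 <= t <= T ->
    forall a b : R, a <= b -> F x t b <= F x t a) ->
  solution alpha nu T G F phi psi u -> solution alpha nu T G F phi psi v ->
  forall x t, closure G x -> 1 <= t <= T -> u x t <= v x t.
Proof.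
move=> a01 nu0 oG bG Fdec su sv x1 t1 Gx1 t1T.
rewrite leNgt; apply/negP => vu1.
pose A := closure G `*` `[1, T]%classic.
have memA x t : closure G x -> 1 <= t <= T -> (x, t) \in A.
  by move=> Gx tT; rewrite inE; split => //=; rewrite in_itv.
have [[x0 t0]] : exists2 c, c \in A &
    forall z, z \in A -> u z.1 z.2 - v z.1 z.2 <= u c.1 c.2 - v c.1 c.2.
  apply: (@compact_EVT_max _ R (fun z => u z.1 z.2 - v z.1 z.2)).
  - by exists (x1, t1); rewrite -inE; exact: memA.
  - by apply: compact_setX; [exact: bounded_closure_compact|exact: segment_compact].
  - move=> z; apply: continuousB.
      exact: (sol_continuous su).
    exact: (sol_continuous sv).
rewrite inE /A => -[/= Gx0]; rewrite in_itv/= => t0T wmax.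
have w0 : v x0 t0 < u x0 t0.
  have /= := wmax _ (memA _ _ Gx1 t1T); lra.
have t0_gt1 : 1 < t0 <= T.
  move: (t0T) => /andP[t0_ge1 ->]; rewrite andbT lt_neqAle t0_ge1 andbT.
  apply/eqP => t01; move: w0; rewrite -t01 (sol_initial su)// (sol_initial sv)//.
  by rewrite ltxx.
have intG : G x0.
  apply: contrapT => nG.
  have bx0 : boundary G x0 by split=> //; rewrite ((interior_id G).1 oG).
  by move: w0; rewrite (sol_boundary su)// (sol_boundary sv)// ltxx.
have lap : laplacian (fun y => u y t0) x0 <= laplacian (fun y => v y t0) x0.
  apply: (@laplacian_sub_at_max _ _ G) => //.
  - by case: (sol_C2 su t0_gt1).
  - by case: (sol_C2 sv t0_gt1).
  - by move=> y Gy; apply: (wmax (y, t0)); apply: memA => //; exact: subset_closure.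
have ct w : {within A, continuous (fun z => w z.1 z.2 : R)} ->
    {within `[1, T], continuous (w x0)}.
  move=> /subspace_continuousP cw; apply/subspace_continuousP => s sI.
  have As : A (x0, s) by [].
  move=> P nP; have AP := cw _ As P nP.
  have cp : (x0, r) @[r --> s] --> (x0, s).
    exact: (cvg_pair (cvg_cst x0) cvg_id).
  have hs : \forall r \near s, A (x0, r) -> P (w x0 r) := cp _ AP.
  have hI : \forall r \near s, `[1, T]%classic r -> P (w x0 r).
    by apply: filterS hs => r hr Ir; exact: hr.
  exact: hI.
have /andP[t0_1 t0_T] := t0_gt1.
have had : hadamard alpha T (v x0) t0 < hadamard alpha T (u x0) t0.
  apply: hadamard_lt_at_max => //.
  - exact: (ct u (sol_continuous su)).
  - exact: (ct v (sol_continuous sv)).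
  - exact: (sol_H1 su).
  - exact: (sol_H1 sv).
  - exact: (sol_defined su).
  - exact: (sol_defined sv).
  - move=> s /andP[s1 st]; apply: (wmax (x0, s)); apply: memA => //.
    by rewrite s1/= (le_trans (ltW st)).
  - by rewrite (sol_initial su)// (sol_initial sv)// subrr subr_gt0.
have Fuv := Fdec x0 t0 Gx0 t0T _ _ (ltW w0).
move: had; rewrite (sol_equation su)// (sol_equation sv)//.
apply/negP; rewrite -leNgt; apply: lerD Fuv.
by rewrite ler_wpM2l// ltW.
Qed.

End Comparison.

Theorem theorem4p7 (R : realType) (n : nat) (alpha nu T : R)
    (G : set 'rV[R]_n) (F : 'rV[R]_n -> R -> R -> R)
    (phi : 'rV[R]_n -> R) (psi : 'rV[R]_n -> R -> R)
    (n_gt0 : (0 < n)%N)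
    (alpha_itv : 0 < alpha < 1) (nu_gt0 : 0 < nu) (T_gt1 : 1 < T)
    (G_domain : domain G) (G_bounded : bounded_set G)
    (G_smooth : smooth_boundary G)
    (F_continuous :
      {within (closure G `*` `[1, T]%classic) `*` setT,
        continuous (fun z : ('rV[R]_n * R) * R => F z.1.1 z.1.2 z.2)})
    (phi_continuous : {within closure G, continuous phi})
    (psi_continuous :
      {within boundary G `*` `[1, T]%classic,
        continuous (fun z : 'rV[R]_n * R => psi z.1 z.2)})
    (F_nonincreasing : forall x t, closure G x -> 1 <= t <= T ->
      forall a b : R, a <= b -> F x t b <= F x t a)
    (u v : 'rV[R]_n -> R -> R)
    (u_solution : solution alpha nu T G F phi psi u)
    (v_solution : solution alpha nu T G F phi psi v) :
  forall x t, closure G x -> 1 <= t <= T -> u x t = v x t.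
Proof.
have [oG _ _] := G_domain.
move=> x t Gx tT; apply/eqP; rewrite eq_le; apply/andP; split.
  exact: (solution_le alpha_itv nu_gt0 oG G_bounded F_nonincreasing
    u_solution v_solution).
exact: (solution_le alpha_itv nu_gt0 oG G_bounded F_nonincreasing
  v_solution u_solution).
Qed.
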